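(* In the folding setting described in the context: (1) For all $\alpha^\vee\in Q^\vee_A$ and $\lambda\in P'_A$, $\langle\varphi(\alpha^\vee),\psi(\lambda)\rangle=\kappa\,\langle\alpha^\vee,\lambda\rangle$. (2) For all $\Lambda\in P'_A$ and $w\in W_A$, $\psi(w\Lambda)=f(w)\psi(\Lambda)$. (3) For all $w\in W_A$, $\Lambda\in P'_A$ and $\alpha^\vee\in Q_A^\vee$, $\langle\varphi(\alpha^\vee),f(w)\psi(\Lambda)\rangle=\kappa\langle\alpha^\vee,w\Lambda\rangle$; in particular, for $i\in I$, $\langle\tilde\beta_i^\vee,f(w)\psi(\Lambda)\rangle=\kappa\langle\alpha_i^\vee,w\Lambda\rangle$, where $\tilde\beta_i^\vee=\sum_{j\in O_i}\beta_j^\vee$. (4) The map $\varphi$ sends $Q^\vee_A\cap Z(\mathfrak{g}(A))$ into $Z(\mathfrak{g}(B))$.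
   Context: Let $B=(b_{jk})_{j,k\in J}$ be a generalized Cartan matrix (GCM) and $\pi$ a permutation of $J$ with $b_{\pi(j)\pi(k)}=b_{jk}$ for all $j,k$, which is admissible: $b_{jk}=0$ whenever $j,k$ lie in the same $\pi$-orbit. Let $I$ index the $\pi$-orbits, $O_i\subset J$ the orbit indexed by $i$, $o_i=|O_i|$, and let $A=(a_{i'i})_{i',i\in I}$ be the GCM given by $a_{i'i}=\frac{o_{i'}}{o_i}\sum_{j\in O_i}b_{j'j}$ for any $j'\in O_{i'}$. For $\mathfrak{g}(A)$ let $\alpha_i,\alpha_i^\vee,\Lambda_i$ be the simple roots, simple coroots, fundamental weights and $W_A$ the Weyl group with generators $s_i^A$; for $\mathfrak{g}(B)$ let $\beta_j,\beta_j^\vee,\omega_j$ and $W_B$ with generators $s_j^B$ be the analogous data. $Q^\vee_A,Q^\vee_B$ are the coroot lattices. $P'_A$ is the weight lattice of $\mathfrak{g}(A)$ modulo the annihilator of all the $\alpha_i^\vee$ (so the pairing with coroots and the $W_A$-action descend to it), similarly $P'_B$; $\alpha_i,\Lambda_i$ etc. also denote their images. Let $\kappa=\mathrm{lcm}_{i\in I}(o_i)$. Define $\psi:P'_A\to P'_B$ linearly by $\psi(\Lambda_i)=\frac{\kappa}{o_i}\sum_{j\in O_i}\omega_j$ and $\varphi:Q^\vee_A\to Q^\vee_B$ by $\varphi(\alpha_i^\vee)=\sum_{j\in O_i}\beta_j^\vee$. Let $f:W_A\to W_B$ be the group homomorphism with $f(s_i^A)=\prod_{j\in O_i}s_j^B$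 (the factors commute by admissibility; $f$ is a well-defined injective homomorphism). $Z(\mathfrak{g})$ denotes the center. *)

(* Defs.v *)
From HB Require Import structures.
From mathcomp Require Import all_boot all_order perm all_algebra.
From mathcomp Require Import boolp.

Set Implicit Arguments.
Unset Strict Implicit.
Unset Printing Implicit Defensive.

Import GRing.Theory.
Local Open Scope ring_scope.
Local Open Scope quotient_scope.

Record gcm (I : finType) := Gcm {
  gcm_entry :> I -> I -> int;
  gcm_diag : forall i, gcm_entry i i = 2;
  gcm_offdiag : forall i k, i != k -> gcm_entry i k <= 0;
  gcm_zero : forall i k, gcm_entry i k = 0 -> gcm_entry k i = 0
}.

Definition gcm_automorphism (J : finType) (B : gcm J) (pi : {perm J}) : Prop :=
  forall j k, B (pi j) (pi k) = B j k.

(* Only distinct elements of an orbit are meant, since b_jj = 2.               *)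
Definition admissible (J : finType) (B : gcm J) (pi : {perm J}) : Prop :=
  forall j k, k \in porbit pi j -> k != j -> B j k = 0.

Definition indexes_orbits (I J : finType) (pi : {perm J}) (O : I -> {set J}) :
    Prop :=
  injective O /\ [set O i | i : I] = porbits pi.

Definition is_folding (I J : finType) (B : gcm J) (O : I -> {set J})
    (A : gcm I) : Prop :=
  forall i' i j', j' \in O i' ->
    (A i' i)%:~R
      = #|O i'|%:R / #|O i|%:R * \sum_(j in O i) (B j' j)%:~R :> rat.

Definition orbit_lcm (I J : finType) (O : I -> {set J}) : nat :=
  \big[lcmn/1%N]_(i : I) #|O i|.

Section Realization.

Variables (K : fieldType) (I : finType) (A : gcm I).

Definition gcm_mx : 'M[K]_#|I| :=
  \matrix_(i, k) (A (enum_val i) (enum_val k))%:~R.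

(* Kac's realization of A: <coroot i, simple_root k> = a_ik, both families are        *)
(* linearly independent, and dim h = 2 n - rank A.                             *)
Record realization := Realization {
  cartan : vectType K;
  coroot : I -> cartan;
  simple_root : I -> 'Hom(cartan, K^o);
  coroot_free : free (codom coroot);
  root_free : free (codom simple_root);
  root_coroot : forall i k, simple_root k (coroot i) = (A i k)%:~R;
  dim_cartan : \dim {: cartan} = (2 * #|I| - \rank gcm_mx)%N
}.

End Realization.

Arguments realization K {I} A.

Section LieAlgebra.

Variable K : fieldType.

Record lie_algebra := LieAlgebra {
  lie_sort :> lmodType K;
  bracket : lie_sort -> lie_sort -> lie_sort;
  bracket_linear_l : forall y, linear (bracket^~ y);
  bracket_linear_r : forall x, linear (bracket x);
  bracket_xx : forall x, bracket x x = 0;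
  bracket_jacobi : forall x y z,
    bracket x (bracket y z) + bracket y (bracket z x) + bracket z (bracket x y)
      = 0
}.

Variable g : lie_algebra.

Definition is_subspace (S : g -> Prop) : Prop :=
  S 0 /\ forall (a : K) (x y : g), S x -> S y -> S (a *: x + y).

Definition is_subalgebra (S : g -> Prop) : Prop :=
  is_subspace S /\ forall x y, S x -> S y -> S (bracket x y).

Definition is_ideal (S : g -> Prop) : Prop :=
  is_subspace S /\ forall x y, S y -> S (bracket x y).

Definition lie_center (z : g) : Prop := forall x, bracket z x = 0.

End LieAlgebra.

(* The Kac-Moody algebra g(A), i.e. the Lie algebra generated by h, e_i, f_i   *)
(* with the relations below, modulo the largest ideal meeting h trivially. It  *)
(* is given here by the properties that determine it up to isomorphism         *)
(* [Kac, Infinite dimensional Lie algebras, Prop. 1.4].                        *)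
Record kac_moody (K : fieldType) (I : finType) (A : gcm I)
    (R : realization K A) := KacMoody {
  km_lie :> lie_algebra K;
  km_h : {linear cartan R -> km_lie};
  km_e : I -> km_lie;
  km_f : I -> km_lie;
  km_h_inj : injective km_h;
  km_hh : forall h h', bracket (km_h h) (km_h h') = 0;
  km_ef : forall i k,
    bracket (km_e i) (km_f k) = if i == k then km_h (coroot R i) else 0;
  km_he : forall h i, bracket (km_h h) (km_e i) = simple_root R i h *: km_e i;
  km_hf : forall h i, bracket (km_h h) (km_f i) = - simple_root R i h *: km_f i;
  km_gen : forall S : km_lie -> Prop, is_subalgebra S ->
    (forall h, S (km_h h)) -> (forall i, S (km_e i)) -> (forall i, S (km_f i)) ->
    forall x, S x;
  km_ideal : forall S : km_lie -> Prop, is_ideal S ->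
    (forall h, S (km_h h) -> h = 0) -> forall x, S x -> x = 0
}.

Section Lattices.

Variables (K : fieldType) (I : finType) (A : gcm I).
Variable R : realization K A.

Definition in_coroot_lattice : {pred cartan R} := fun x =>
  `[< exists c : I -> int, x = \sum_i coroot R i *~ c i >].

Lemma in_coroot_lattice_zmod : zmod_closed in_coroot_lattice.
Proof.
split=> [|x y /asboolP[c ->] /asboolP[d ->]]; apply/asboolP.
  by exists (fun=> 0); rewrite big1 // => i _; rewrite mulr0z.
exists (fun i => c i - d i); rewrite -sumrB; apply: eq_bigr => i _.
by rewrite mulrzBr.
Qed.

HB.instance Definition _ :=
  GRing.isZmodClosed.Build (cartan R) in_coroot_lattice in_coroot_lattice_zmod.

Record coroot_lattice := CorootLattice {
  coroot_lattice_val : cartan R;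
  _ : coroot_lattice_val \in in_coroot_lattice }.

HB.instance Definition _ := [isSub for coroot_lattice_val].
HB.instance Definition _ := [Choice of coroot_lattice by <:].
HB.instance Definition _ := [SubChoice_isSubZmodule of coroot_lattice by <:].

Lemma coroot_in_lattice i : coroot R i \in in_coroot_lattice.
Proof.
apply/asboolP; exists (fun k => (k == i)%:Z); rewrite (bigD1 i) //= eqxx mulr1z.
by rewrite big1 ?addr0 // => k /negPf ->; rewrite mulr0z.
Qed.

Definition simple_coroot i : coroot_lattice := CorootLattice (coroot_in_lattice i).

Definition is_weight : {pred 'Hom(cartan R, K^o)} := fun l =>
  `[< forall i, exists z : int, l (coroot R i) = z%:~R >].

Lemma is_weight_zmod : zmod_closed is_weight.
Proof.
split=> [|l m /asboolP hl /asboolP hm]; apply/asboolP=> i.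
  by exists 0; rewrite zero_lfunE.
have [[a la] [b mb]] := (hl i, hm i).
by exists (a - b); rewrite add_lfunE opp_lfunE la mb mulrzBr.
Qed.

HB.instance Definition _ :=
  GRing.isZmodClosed.Build 'Hom(cartan R, K^o) is_weight is_weight_zmod.

Record weight := Weight {
  weight_val : 'Hom(cartan R, K^o);
  _ : weight_val \in is_weight }.

HB.instance Definition _ := [isSub for weight_val].
HB.instance Definition _ := [Choice of weight by <:].
HB.instance Definition _ := [SubChoice_isSubZmodule of weight by <:].

Definition coroot_annihilator : {pred weight} := fun l =>
  [forall i, weight_val l (coroot R i) == 0].

Lemma coroot_annihilator_zmod : zmod_closed coroot_annihilator.
Proof.
split=> [|l m /forallP hl /forallP hm]; apply/forallP=> i.
  by rewrite zero_lfunE.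
by rewrite add_lfunE opp_lfunE /= (eqP (hl i)) (eqP (hm i)) subr0.
Qed.

HB.instance Definition _ :=
  GRing.isZmodClosed.Build weight coroot_annihilator coroot_annihilator_zmod.

(* The lattice P' = P / {l | <coroot i, l> = 0 for all i}.                     *)
Definition weight' := Quotient.quot coroot_annihilator.
HB.instance Definition _ := GRing.Zmodule.on weight'.

Definition to_weight' (l : weight) : weight' := \pi_(Quotient.quot _) l.

Lemma to_weight'P (l m : weight) :
  reflect (forall i, weight_val l (coroot R i) = weight_val m (coroot R i))
          (to_weight' l == to_weight' m).
Proof.
rewrite -Quotient.idealrBE.
apply: (iffP forallP) => h i; last by rewrite add_lfunE opp_lfunE /= h subrr.
by apply/eqP; rewrite -subr_eq0; have := h i; rewrite add_lfunE opp_lfunE.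
Qed.

(* <x, l> for x in the coroot lattice and l in P'; independent of the          *)
(* representative of l by pairingE.                                            *)
Definition pairing (x : coroot_lattice) (l : weight') : K :=
  weight_val (repr l) (coroot_lattice_val x).

Lemma pairingE x l :
  pairing x (to_weight' l) = weight_val l (coroot_lattice_val x).
Proof.
rewrite /pairing; set m := repr _.
have /eqP/to_weight'P hm : to_weight' m = to_weight' l by exact: reprK.
case: x => x /= /asboolP[c ->]; rewrite !linear_sum; apply: eq_bigr => i _.
by rewrite !raddfMz /= hm.
Qed.

Definition is_fundamental (L : I -> weight) : Prop :=
  forall i k, weight_val (L i) (coroot R k) = (k == i)%:R.

End Lattices.

Section Weyl.

Variables (K : fieldType) (I : finType) (A : gcm I).
Variable R : realization K A.
Local Notation dual := 'Hom(cartan R, K^o).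
Implicit Types (l : dual) (w : 'End(dual)).

Definition refl_fun (i : I) l : dual := l - l (coroot R i) *: simple_root R i.

Lemma refl_fun_linear i : linear (refl_fun i).
Proof.
move=> a l m; rewrite /refl_fun add_lfunE scale_lfunE scalerDl scalerBr scalerA.
by rewrite opprD addrACA.
Qed.

HB.instance Definition _ i :=
  GRing.isLinear.Build K dual dual *:%R (refl_fun i) (refl_fun_linear i).

Definition refl (i : I) : 'End(dual) := linfun (refl_fun i).

Lemma reflE i l : refl i l = l - l (coroot R i) *: simple_root R i.
Proof. by rewrite lfunE. Qed.

Lemma reflK i : (refl i \o refl i)%VF = \1%VF.
Proof.
apply/lfunP=> l; rewrite comp_lfunE id_lfunE !reflE !(add_lfunE, opp_lfunE).
rewrite scale_lfunE root_coroot gcm_diag.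
set c := l _; set r := simple_root R i.
rewrite -[c *: 2%:~R]/(c * 2%:~R) mulrDr mulr1 opprD addrA subrr add0r.
by rewrite scaleNr opprK subrK.
Qed.

(* The subgroup of GL(h^* ) generated by the simple reflections.               *)
Inductive is_weyl : 'End(dual) -> Prop :=
| is_weyl1 : is_weyl \1%VF
| is_weyl_refl i : is_weyl (refl i)
| is_weylM w1 w2 : is_weyl w1 -> is_weyl w2 -> is_weyl (w1 \o w2)%VF
| is_weylV w : is_weyl w -> is_weyl (w^-1)%VF.

Lemma is_weyl_lker0 w : is_weyl w -> lker w == 0%VS.
Proof.
elim=> {w} [|i|w1 w2 _ k1 _ k2|w _ kw].
- by apply/lker0P=> l m; rewrite !id_lfunE.
- apply/lker0P=> l m e.
  by rewrite -[l]id_lfunE -[m]id_lfunE -(reflK i) !comp_lfunE /= e.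
- apply/lker0P=> l m; rewrite !comp_lfunE.
  by move=> /(lker0P k1) /(lker0P k2).
- apply/lker0P=> l m e.
  by rewrite -[l]id_lfunE -[m]id_lfunE -(lker0_compfV kw) !comp_lfunE e.
Qed.

Definition in_weyl : {pred 'End(dual)} := fun w => `[< is_weyl w >].

Record weyl := Weyl { weyl_val : 'End(dual); _ : weyl_val \in in_weyl }.

HB.instance Definition _ := [isSub for weyl_val].
HB.instance Definition _ := [Choice of weyl by <:].

Lemma weylP (w : weyl) : is_weyl (weyl_val w).
Proof. by apply/asboolP; exact: valP w. Qed.

Definition weyl1 : weyl := Weyl (asboolT is_weyl1).
Definition weylM (w1 w2 : weyl) : weyl :=
  Weyl (asboolT (is_weylM (weylP w1) (weylP w2))).
Definition weylV (w : weyl) : weyl := Weyl (asboolT (is_weylV (weylP w))).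

Lemma weylA : associative weylM.
Proof. by move=> w1 w2 w3; apply: val_inj; rewrite /= comp_lfunA. Qed.
Lemma weyl1w : left_id weyl1 weylM.
Proof. by move=> w; apply: val_inj; rewrite /= comp_lfun1l. Qed.
Lemma weylw1 : right_id weyl1 weylM.
Proof. by move=> w; apply: val_inj; rewrite /= comp_lfun1r. Qed.
Lemma weylVw : left_inverse weyl1 weylV weylM.
Proof.
by move=> w; apply: val_inj; rewrite /= lker0_compVf // is_weyl_lker0 //; apply: weylP.
Qed.
Lemma weylwV : right_inverse weyl1 weylV weylM.
Proof.
by move=> w; apply: val_inj; rewrite /= lker0_compfV // is_weyl_lker0 //; apply: weylP.
Qed.

HB.instance Definition _ :=
  isGroup.Build weyl weylA weyl1w weylw1 weylVw weylwV.

Definition weyl_refl (i : I) : weyl := Weyl (asboolT (is_weyl_refl i)).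

Definition refl_word (s : seq I) : 'End(dual) :=
  foldr (fun i w => (refl i \o w)%VF) \1%VF s.

Lemma refl_word_cat s t :
  refl_word (s ++ t) = (refl_word s \o refl_word t)%VF.
Proof.
by elim: s => [|i s IH] /=; rewrite ?comp_lfun1l // IH comp_lfunA.
Qed.

Lemma refl_wordV s : (refl_word (rev s) \o refl_word s)%VF = \1%VF.
Proof.
elim: s => [|i s IH]; first by rewrite /= comp_lfun1l.
rewrite rev_cons -cats1 refl_word_cat /= comp_lfun1r -comp_lfunA.
by rewrite [(refl i \o (refl i \o _))%VF]comp_lfunA reflK comp_lfun1l.
Qed.

Lemma is_weyl_word w : is_weyl w -> exists s, w = refl_word s.
Proof.
elim=> {w} [|i|w1 w2 _ [s ->] _ [t ->]|w ww [s e]].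
- by exists [::].
- by exists [:: i]; rewrite /= comp_lfun1r.
- by exists (s ++ t); rewrite refl_word_cat.
exists (rev s); rewrite -[RHS]comp_lfun1r -(lker0_compfV (is_weyl_lker0 ww)).
by rewrite comp_lfunA {2}e refl_wordV comp_lfun1l.
Qed.

Lemma is_weight_weyl w l :
  is_weyl w -> l \in @is_weight K I A R -> w l \in @is_weight K I A R.
Proof.
move=> /is_weyl_word[s ->]; elim: s => [|i s IH] /= hl.
  by rewrite id_lfunE.
have /asboolP {}IH := IH hl; rewrite comp_lfunE reflE.
apply/asboolP=> k; have [[a ea] [b eb]] := (IH i, IH k).
exists (b - a * A k i); rewrite add_lfunE opp_lfunE scale_lfunE ea eb.
by rewrite root_coroot mulrzBr intrM.
Qed.

Definition weyl_act_weight (w : weyl) (l : weight R) : weight R :=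
  Weight (is_weight_weyl (weylP w) (valP l)).

(* The induced action on P'; independent of representatives by weyl_actE.      *)
Definition weyl_act (w : weyl) (l : weight' R) : weight' R :=
  to_weight' (weyl_act_weight w (repr l)).

Lemma weyl_actE (w : weyl) (l : weight R) :
  weyl_act w (to_weight' l) = to_weight' (weyl_act_weight w l).
Proof.
apply/eqP/to_weight'P; set m := repr _.
have /eqP/to_weight'P hm : to_weight' m = to_weight' l by exact: reprK.
have [s /= ->] := is_weyl_word (weylP w).
elim: s => [|i s IH] k /=; first by rewrite !id_lfunE hm.
by rewrite !comp_lfunE !reflE !add_lfunE !opp_lfunE !scale_lfunE !IH.
Qed.

End Weyl.

Arguments weyl_refl {K I A} R i.
Arguments simple_coroot {K I A} R i.

(* Main.v *)
(* An element of P' is determined by its pairings with the simple coroots, and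
   in these coordinates psi copies the A-coordinate at i, scaled by kappa / o_i,
   to every j in O_i; this gives (1).  By admissibility the reflections over an
   orbit do not interact, so (2) for a simple reflection is the identity
   (kappa / o_k) a_ki = (kappa / o_i) sum_(a in O_i) b_ja for j in O_k, and (3)
   combines (1) and (2).  For (4), an element of the Cartan subalgebra is
   central iff every simple root kills it, and beta_j o phi = alpha_k for j in
   O_k: counting the O_i x O_k block of B by rows and by columns gives
   sum_(a in O_i) b_aj = a_ik. *)
Require Import Defs.
From HB Require Import structures.
From mathcomp Require Import all_boot all_order perm all_algebra.
From mathcomp Require Import boolp ring.

Set Implicit Arguments.
Unset Strict Implicit.
Unset Printing Implicit Defensive.

Import GRing.Theory Num.Theory.
Local Open Scope ring_scope.

Lemma multiplicative_gmulf1 (G H : groupType) (f : {multiplicative G -> H}) :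
  f 1%g = 1%g.
Proof. by apply: (mulgI (f 1%g)); rewrite -gmulfM !mulg1. Qed.

Section Lattices.

Variables (K : fieldType) (I : finType) (A : gcm I) (R : realization K A).
Implicit Types (x : coroot_lattice R) (l m : weight' R).

Lemma coroot_lattice_val_is_zmod_morphism :
  zmod_morphism (@coroot_lattice_val K I A R).
Proof. exact: (raddfB \val). Qed.

HB.instance Definition _ :=
  GRing.isZmodMorphism.Build (coroot_lattice R) (cartan R)
    (@coroot_lattice_val K I A R) coroot_lattice_val_is_zmod_morphism.

Lemma to_weight'_repr l : to_weight' (repr l) = l.
Proof. exact: reprK. Qed.

Lemma pairing_is_zmod_morphism x : zmod_morphism (pairing x).
Proof.
move=> l m; rewrite -(to_weight'_repr l) -(to_weight'_repr m) /to_weight'.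
rewrite -raddfB -!/(to_weight' _) !pairingE.
by rewrite /= add_lfunE opp_lfunE.
Qed.

HB.instance Definition _ x :=
  GRing.isZmodMorphism.Build (weight' R) K (pairing x)
    (pairing_is_zmod_morphism x).

Definition pairingr l x : K := pairing x l.

Lemma pairingr_is_zmod_morphism l : zmod_morphism (pairingr l).
Proof. by move=> x y; rewrite /pairingr /pairing !raddfB. Qed.

HB.instance Definition _ l :=
  GRing.isZmodMorphism.Build (coroot_lattice R) K (pairingr l)
    (pairingr_is_zmod_morphism l).

Lemma pairing_simple_coroot_inj l m :
  (forall i, pairing (simple_coroot R i) l = pairing (simple_coroot R i) m) ->
  l = m.
Proof.
rewrite -(to_weight'_repr l) -(to_weight'_repr m) => eq_lm.
by apply/eqP/to_weight'P => i; have := eq_lm i; rewrite !pairingE.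
Qed.

Lemma pairing_fundamental (L : I -> weight R) (fundL : is_fundamental L) i k :
  pairing (simple_coroot R i) (to_weight' (L k)) = (i == k)%:R.
Proof. by rewrite pairingE fundL. Qed.

Lemma coroot_lattice_sum x :
  exists c : I -> int, x = \sum_i simple_coroot R i *~ c i.
Proof.
have /asboolP[c x_sum] := valP x; exists c; apply: val_inj.
by rewrite /= x_sum raddf_sum; apply: eq_bigr => i _; rewrite raddfMz.
Qed.

Lemma weight'_sum (L : I -> weight R) (fundL : is_fundamental L) l :
  exists c : I -> int, l = \sum_i to_weight' (L i) *~ c i.
Proof.
have /asboolP/choice[c l_c] := valP (repr l).
exists c; apply: pairing_simple_coroot_inj => k.
rewrite [LHS]l_c raddf_sum (bigD1 k) //= big1 => [|i /negPf neq_ik].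
  by rewrite raddfMz /= pairing_fundamental // eqxx addr0.
by rewrite raddfMz /= pairing_fundamental // eq_sym neq_ik mul0rz.
Qed.

Lemma additive_coroot_lattice_ext (V : zmodType)
    (F G : {additive coroot_lattice R -> V}) :
  (forall i, F (simple_coroot R i) = G (simple_coroot R i)) -> F =1 G.
Proof.
move=> eqFG x; have [c ->] := coroot_lattice_sum x.
by rewrite !raddf_sum; apply: eq_bigr => i _; rewrite !raddfMz /= eqFG.
Qed.

Lemma additive_weight'_ext (V : zmodType) (F G : {additive weight' R -> V})
    (L : I -> weight R) :
    is_fundamental L ->
  (forall i, F (to_weight' (L i)) = G (to_weight' (L i))) -> F =1 G.
Proof.
move=> fundL eqFG l; have [c ->] := weight'_sum fundL l.
by rewrite !raddf_sum; apply: eq_bigr => i _; rewrite !raddfMz /= eqFG.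
Qed.

End Lattices.

Section WeylAction.

Variables (K : fieldType) (I : finType) (A : gcm I) (R : realization K A).
Implicit Types (v w : weyl R) (l : weight' R).

Lemma weyl_act1 l : weyl_act 1%g l = l.
Proof.
rewrite -(to_weight'_repr l) weyl_actE; congr to_weight'.
by apply: val_inj; rewrite /= id_lfunE.
Qed.

Lemma weyl_actM v w l : weyl_act (v * w)%g l = weyl_act v (weyl_act w l).
Proof.
rewrite -(to_weight'_repr l) !weyl_actE; congr to_weight'.
by apply: val_inj; rewrite /= comp_lfunE.
Qed.

Lemma weyl_prod_refl w : exists s, w = (\prod_(i <- s) weyl_refl R i)%g.
Proof.
have [s w_s] := is_weyl_word (weylP w); exists s; apply: val_inj.
rewrite /= w_s; elim: s {w_s} => [|i s IH] /=; first by rewrite big_nil.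
by rewrite big_cons IH.
Qed.

Lemma pairing_weyl_refl i k l :
  pairing (simple_coroot R k) (weyl_act (weyl_refl R i) l) =
    pairing (simple_coroot R k) l - pairing (simple_coroot R i) l * (A k i)%:~R.
Proof.
rewrite -(to_weight'_repr l) weyl_actE !pairingE /= reflE.
by rewrite add_lfunE opp_lfunE scale_lfunE root_coroot.
Qed.

Lemma pairing_weyl_prod_refl_seq (s : seq I) k l :
    uniq s -> {in s &, forall i i', i != i' -> A i i' = 0} ->
  pairing (simple_coroot R k) (weyl_act (\prod_(i <- s) weyl_refl R i)%g l) =
    pairing (simple_coroot R k) l
      - \sum_(i <- s) pairing (simple_coroot R i) l * (A k i)%:~R.
Proof.
elim: s k => [|a s IH] k; first by rewrite !big_nil weyl_act1 subr0.
rewrite cons_uniq => /andP[a_notin_s uniq_s] A0.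
have A0s : {in s &, forall i i', i != i' -> A i i' = 0}.
  by move=> i i' si si'; apply: A0; rewrite inE ?si ?si' orbT.
have A0a : \sum_(i <- s) pairing (simple_coroot R i) l * (A a i)%:~R = 0.
  rewrite big1_seq // => i /andP[_ si].
  rewrite (A0 a i) ?mulr0 ?inE ?eqxx ?si ?orbT //.
  by apply: contraNneq a_notin_s => ->.
rewrite !big_cons weyl_actM pairing_weyl_refl !IH // A0a subr0.
by rewrite opprD addrA addrAC.
Qed.

Lemma pairing_weyl_prod_refl (S : {set I}) k l :
    {in S &, forall i i', i != i' -> A i i' = 0} ->
  pairing (simple_coroot R k) (weyl_act (\prod_(i in S) weyl_refl R i)%g l) =
    pairing (simple_coroot R k) l
      - \sum_(i in S) pairing (simple_coroot R i) l * (A k i)%:~R.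
Proof.
move=> A0; rewrite -!(big_filter _ [in S]) pairing_weyl_prod_refl_seq //.
  by rewrite filter_uniq ?index_enum_uniq.
by move=> i i'; rewrite !mem_filter => /andP[Si _] /andP[Si' _]; exact: A0.
Qed.

End WeylAction.

Section LieAlgebras.

Variables (K : fieldType) (g : lie_algebra K).
Implicit Types x y z : g.

Lemma bracket_is_bilinear : bilinear_for *:%R *:%R (@bracket K g).
Proof.
by split=> [y|x]; [exact: bracket_linear_l|exact: bracket_linear_r].
Qed.

HB.instance Definition _ :=
  bilinear_isBilinear.Build K g g g *:%R *:%R (@bracket K g)
    bracket_is_bilinear.

Lemma bracketC x y : bracket x y = - bracket y x.
Proof.
have := bracket_xx (x + y); rewrite linearDl !linearDr /= !bracket_xx.
by rewrite add0r addr0 => /addr0_eq <-; rewrite opprK.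
Qed.

Lemma centralizer_subalgebra x : is_subalgebra (fun y => bracket x y = 0).
Proof.
split; first split=> [|a y z xy0 xz0]; first exact: linear0r.
  by rewrite bracket_linear_r xy0 xz0 scaler0 addr0.
move=> y z xy0 xz0; have := bracket_jacobi x y z.
by rewrite xy0 (bracketC z x) xz0 oppr0 !linear0r !addr0.
Qed.

End LieAlgebras.

Section KacMoody.

Variables (K : fieldType) (I : finType) (A : gcm I) (R : realization K A).
Variable g : kac_moody R.

Lemma coroot_neq0 i : coroot R i != 0.
Proof. exact: free_not0 (coroot_free R) (codom_f _ i). Qed.

Lemma km_e_neq0 i : km_e g i != 0.
Proof.
apply: contra_neq (coroot_neq0 i) => e0; apply: (@km_h_inj _ _ _ _ g).
by rewrite raddf0; have := km_ef g i i; rewrite eqxx e0 linear0l.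
Qed.

Lemma km_h_center h :
  lie_center (km_h g h) <-> forall i, simple_root R i h = 0.
Proof.
split=> [h_center i | h0].
  have /eqP := km_he g h i; rewrite h_center eq_sym scaler_eq0.
  by rewrite (negPf (km_e_neq0 i)) orbF => /eqP.
apply: (km_gen (centralizer_subalgebra (km_h g h))) => [h'|i|i].
- by rewrite km_hh.
- by rewrite km_he h0 scale0r.
- by rewrite km_hf h0 oppr0 scale0r.
Qed.

End KacMoody.

Section Orbits.

Variables (J : finType) (pi : {perm J}).
Variables (I : finType) (O : I -> {set J}) (orbO : indexes_orbits pi O).

Lemma orbit_in_porbits i : O i \in porbits pi.
Proof. by rewrite -orbO.2 imset_f. Qed.

Lemma orbit_porbit i j : j \in O i -> O i = porbit pi j.
Proof.
by have /imsetP[k _ ->] := orbit_in_porbits i; rewrite -eq_porbit_mem => /eqP.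
Qed.

Lemma orbit_index_uniq i k j : j \in O i -> j \in O k -> i = k.
Proof.
by move=> /orbit_porbit Oi /orbit_porbit Ok; apply: orbO.1; rewrite Oi Ok.
Qed.

Lemma orbit_cover j : exists i, j \in O i.
Proof.
have: porbit pi j \in [set O i | i : I] by rewrite orbO.2 imset_f.
by case/imsetP=> i _ Oi; exists i; rewrite -Oi porbit_id.
Qed.

Lemma card_orbit_gt0 i : (0 < #|O i|)%N.
Proof.
by have /imsetP[k _ ->] := orbit_in_porbits i; rewrite lt0n card_porbit_neq0.
Qed.

Lemma natr_card_orbit_neq0 (F : numDomainType) i : #|O i|%:R != 0 :> F.
Proof. by rewrite pnatr_eq0 -lt0n card_orbit_gt0. Qed.

Lemma orbit_stable i j : (pi j \in O i) = (j \in O i).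
Proof.
have /imsetP[k _ ->] := orbit_in_porbits i.
by rewrite -!eq_porbit_mem; have /= -> := porbit_perm pi 1 j.
Qed.

Lemma dvdn_orbit_lcm i : (#|O i| %| orbit_lcm O)%N.
Proof. by rewrite /orbit_lcm (bigD1 i) //= dvdn_lcml. Qed.

End Orbits.

Section FoldedMatrix.

Variables (J : finType) (B : gcm J) (pi : {perm J}).
Variables (I : finType) (O : I -> {set J}) (orbO : indexes_orbits pi O).
Variables (A : gcm I) (foldA : is_folding B O A).

Lemma admissible_orbit i :
  admissible B pi -> {in O i &, forall j j', j != j' -> B j j' = 0}.
Proof.
move=> admB j j' Oj Oj' neq_jj'.
by apply: admB; rewrite 1?eq_sym // -(orbit_porbit orbO Oj).
Qed.

Lemma folding_row_lcm i k j : j \in O k ->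
  (orbit_lcm O %/ #|O k|)%:R * A k i =
    (orbit_lcm O %/ #|O i|)%:R * \sum_(j' in O i) B j j'.
Proof.
move=> Oj; apply: (@intr_inj rat); rewrite !intrM rmorph_sum /= !rmorph_nat.
rewrite !natf_div ?dvdn_orbit_lcm // (foldA i Oj).
by field; rewrite !(natr_card_orbit_neq0 orbO).
Qed.

Lemma folding_block_sum i k :
  \sum_(j in O i) \sum_(j' in O k) B j j' = A i k *+ #|O k|.
Proof.
apply: (@intr_inj rat); rewrite rmorph_sum rmorphMn /=.
rewrite (eq_bigr (fun=> #|O k|%:R / #|O i|%:R * (A i k)%:~R)) => [|j Oj].
  rewrite sumr_const -[LHS]mulr_natr mulrAC -[RHS]mulr_natl.
  by rewrite divfK ?(natr_card_orbit_neq0 orbO).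
rewrite rmorph_sum /= (foldA k Oj).
by field; rewrite !(natr_card_orbit_neq0 orbO).
Qed.

Hypothesis autB : gcm_automorphism B pi.

Lemma column_sum_perm i j :
  \sum_(j' in O i) B j' (pi j) = \sum_(j' in O i) B j' j.
Proof.
rewrite (reindex_inj (@perm_inj _ pi)) /=.
by apply: eq_big => [j' | j' _]; rewrite ?(orbit_stable orbO) ?autB.
Qed.

Lemma column_sum_orbit i k j j' : j \in O k -> j' \in O k ->
  \sum_(a in O i) B a j' = \sum_(a in O i) B a j.
Proof.
move=> Oj; rewrite (orbit_porbit orbO Oj) => /porbitP[n ->].
by elim: n => [|n IH]; rewrite ?expg0 ?perm1 // expgSr permM column_sum_perm.
Qed.

Lemma folding_column_sum i k j : j \in O k -> \sum_(j' in O i) B j' j = A i k.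
Proof.
move=> Oj; apply: (pmulrnI (card_orbit_gt0 orbO k)).
rewrite -folding_block_sum exchange_big /= -sumr_const.
by apply: eq_bigr => a Oa; exact: column_sum_orbit Oa Oj.
Qed.

End FoldedMatrix.

Section FoldingMaps.

Variables (K : fieldType) (J : finType) (B : gcm J) (pi : {perm J}).
Variables (I : finType) (O : I -> {set J}) (orbO : indexes_orbits pi O).
Variables (A : gcm I) (foldA : is_folding B O A).
Variables (RA : realization K A) (RB : realization K B).
Local Notation kappa := (orbit_lcm O).

Variables (Lambda : I -> weight RA) (fundA : is_fundamental Lambda).
Variables (omega : J -> weight RB) (fundB : is_fundamental omega).
Variable psi : {additive weight' RA -> weight' RB}.
Hypothesis psiE : forall i, psi (to_weight' (Lambda i)) =
  (\sum_(j in O i) to_weight' (omega j)) *+ (kappa %/ #|O i|).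

Variable phi : {additive coroot_lattice RA -> coroot_lattice RB}.
Hypothesis phiE : forall i,
  phi (simple_coroot RA i) = \sum_(j in O i) simple_coroot RB j.

Variable f : {multiplicative weyl RA -> weyl RB}.
Hypothesis fE : forall i,
  f (weyl_refl RA i) = (\prod_(j in O i) weyl_refl RB j)%g.

Lemma pairing_psi i j l : j \in O i ->
  pairing (simple_coroot RB j) (psi l) =
    (kappa %/ #|O i|)%:R * pairing (simple_coroot RA i) l.
Proof.
move=> Oj; move: l.
apply: (additive_weight'_ext (F := pairing (simple_coroot RB j) \o psi)
  (G := (kappa %/ #|O i|)%:R \*o pairing (simple_coroot RA i)) fundA) => k /=.
rewrite psiE raddfMn raddf_sum pairing_fundamental //= mulr_natl.
under eq_bigr => a _ do rewrite pairing_fundamental //.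
have [<-|neq_ik] := eqVneq i k.
  rewrite (bigD1 j) //= eqxx big1 ?addr0 // => a /andP[_ neq_aj].
  by rewrite eq_sym (negPf neq_aj).
rewrite mul0rn big1 ?mul0rn // => a Oa; case: eqP => // eq_ja.
by case/eqP: neq_ik; apply: (orbit_index_uniq orbO Oj); rewrite eq_ja.
Qed.

Lemma pairing_phi_psi x l : pairing (phi x) (psi l) = kappa%:R * pairing x l.
Proof.
move: x; apply: (additive_coroot_lattice_ext (F := pairingr (psi l) \o phi)
  (G := kappa%:R \*o pairingr l)) => i /=.
rewrite phiE raddf_sum (eq_bigr _ (fun j => @pairing_psi i j l)) sumr_const.
by rewrite -mulrnAl -mulrnA divnK // dvdn_orbit_lcm.
Qed.

Hypothesis admB : admissible B pi.

Lemma psi_weyl_refl i l :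
  psi (weyl_act (weyl_refl RA i) l) = weyl_act (f (weyl_refl RA i)) (psi l).
Proof.
apply: pairing_simple_coroot_inj => j; have [k Oj] := orbit_cover orbO j.
rewrite fE pairing_weyl_prod_refl; last exact: (admissible_orbit orbO).
rewrite !(pairing_psi _ Oj) pairing_weyl_refl mulrBr; congr (_ - _).
under eq_bigr => a Oa do rewrite (pairing_psi _ Oa).
rewrite -mulr_sumr -rmorph_sum /=.
have /(congr1 (intr : int -> K)) := folding_row_lcm orbO foldA i Oj.
by rewrite !intrM !rmorph_nat mulrCA mulrAC => ->; rewrite mulrC.
Qed.

Lemma psi_weyl_act w l : psi (weyl_act w l) = weyl_act (f w) (psi l).
Proof.
have [s ->] := weyl_prod_refl w; elim: s => [|i s IH].
  by rewrite !big_nil multiplicative_gmulf1 !weyl_act1.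
by rewrite !big_cons gmulfM !weyl_actM psi_weyl_refl IH.
Qed.

Hypothesis autB : gcm_automorphism B pi.

Lemma simple_root_phi k j x : j \in O k ->
  simple_root RB j (coroot_lattice_val (phi x)) =
    simple_root RA k (coroot_lattice_val x).
Proof.
move=> Oj; move: x.
apply: (additive_coroot_lattice_ext
  (F := simple_root RB j \o coroot_lattice_val (R:=RB) \o phi)
  (G := simple_root RA k \o coroot_lattice_val (R:=RA))) => i /=.
rewrite phiE !raddf_sum root_coroot -(folding_column_sum orbO foldA autB i Oj).
by rewrite rmorph_sum; apply: eq_bigr => a _; exact: root_coroot.
Qed.

End FoldingMaps.

Theorem theorem4p5 (K : fieldType) (charK0 : [pchar K] =i pred0)
    (J : finType) (B : gcm J) (pi : {perm J})
    (autB : gcm_automorphism B pi) (admB : admissible B pi)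
    (I : finType) (O : I -> {set J}) (orbO : indexes_orbits pi O)
    (A : gcm I) (foldA : is_folding B O A)
    (RA : realization K A) (gA : kac_moody RA)
    (RB : realization K B) (gB : kac_moody RB)
    (Lambda : I -> weight RA) (fundA : is_fundamental Lambda)
    (omega : J -> weight RB) (fundB : is_fundamental omega)
    (psi : {additive weight' RA -> weight' RB})
    (psiE : forall i, psi (to_weight' (Lambda i))
       = (\sum_(j in O i) to_weight' (omega j)) *+ (orbit_lcm O %/ #|O i|))
    (phi : {additive coroot_lattice RA -> coroot_lattice RB})
    (phiE : forall i, phi (simple_coroot RA i)
       = \sum_(j in O i) simple_coroot RB j)
    (f : {multiplicative weyl RA -> weyl RB})
    (fE : forall i, f (weyl_refl RA i) = (\prod_(j in O i) weyl_refl RB j)%g) :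
  [/\ forall (x : coroot_lattice RA) (l : weight' RA),
        pairing (phi x) (psi l) = (orbit_lcm O)%:R * pairing x l,
      forall (l : weight' RA) (w : weyl RA),
        psi (weyl_act w l) = weyl_act (f w) (psi l),
      (forall (w : weyl RA) (l : weight' RA) (x : coroot_lattice RA),
        pairing (phi x) (weyl_act (f w) (psi l))
          = (orbit_lcm O)%:R * pairing x (weyl_act w l)) /\
      (forall (w : weyl RA) (l : weight' RA) (i : I),
        pairing (\sum_(j in O i) simple_coroot RB j) (weyl_act (f w) (psi l))
          = (orbit_lcm O)%:R * pairing (simple_coroot RA i) (weyl_act w l))
    & forall x : coroot_lattice RA,
        lie_center (km_h gA (coroot_lattice_val x)) ->
        lie_center (km_h gB (coroot_lattice_val (phi x)))].
Proof.
have psi_equivariant := psi_weyl_act orbO foldA fundA fundB psiE fE admB.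
have pairing_scaled := pairing_phi_psi orbO fundA fundB psiE phiE.
split=> //; first by split=> [w l x|w l i]; rewrite -psi_equivariant -?phiE.
move=> x /km_h_center x_center; apply/km_h_center => j.
have [k Oj] := orbit_cover orbO j.
by rewrite (simple_root_phi orbO foldA phiE autB x Oj).
Qed.
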